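(* Let $n\ge 2$ and let $\Sigma\in\mathbb{R}^{n\times n}$ be a symmetric positive-definite matrix. Equip the open simplex $\Delta^{n-1}$ with the market-only risk metric, i.e. $G(w)=\Sigma$ for all $w\in\Delta^{n-1}$ (the case $\kappa=0$ of $G(w)=\Sigma+\kappa\,\mathrm{diag}(1/w_1,\dots,1/w_n)$), with induced metric $g(u)=J^{\mathsf T}\Sigma J$ in the chart $u$. Then: (1) all Christoffel symbols $\Gamma^k_{ij}$ of $g$ vanish identically; (2) the Riemannian manifold $(\Delta^{n-1},g)$ is flat, i.e. its Riemann curvature tensor vanishes identically (in particular, for $n=3$, the Gaussian curvature satisfies $K\equiv 0$); (3) for any two portfolios $A,B\in\Delta^{n-1}$, the unique risk-geodesic from $A$ to $B$ is the straight-line segment $p_0(t)=(1-t)A+tB$, $t\in[0,1]$ (uniqueness being understood up to reparametrisation). Consequently $p_0$ is exactly risk-optimal: $\mathcal{R}[p_0]\le\mathcal{R}[\gamma]$ for every curve $\gamma$ in $\Delta^{n-1}$ from $A$ to $B$, so no curved route can reduce the transition risk.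
   Context: The space of portfolios is the open probability simplex $\Delta^{n-1}=\{w\in\mathbb{R}^n: w_i>0 \text{ for all } i,\ \sum_{i=1}^n w_i=1\}$, a smooth $(n-1)$-manifold with tangent space $\{v\in\mathbb{R}^n:\sum_i v_i=0\}$ at each point. The global chart is $u=(w_1,\dots,w_{n-1})$ with $w_n=1-\sum_{i<n}w_i$; the embedding $u\mapsto w(u)=(u_1,\dots,u_{n-1},1-\sum_{i<n}u_i)$ has constant Jacobian $J=\begin{bmatrix} I_{n-1}\\ -\mathbf{1}^{\mathsf T}\end{bmatrix}\in\mathbb{R}^{n\times(n-1)}$, where $\mathbf 1$ is the all-ones vector. A risk metric is a smooth map $w\mapsto G(w)$ from $\Delta^{n-1}$ into symmetric positive-definite $n\times n$ matrices; its induced Riemannian metric in the chart is $g(u)=J^{\mathsf T}G(w(u))J$. The Christoffel symbols are $\Gamma^k_{ij}=\tfrac12 g^{k\ell}(\partial_i g_{j\ell}+\partial_j g_{i\ell}-\partial_\ell g_{ij})$ (summation convention), and the curvature is $R^{\ell}{}_{ijk}=\partial_i\Gamma^{\ell}_{jk}-\partial_j\Gamma^{\ell}_{ik}+\Gamma^{\ell}_{im}\Gamma^{m}_{jk}-\Gamma^{\ell}_{jm}\Gamma^{m}_{ik}$; for $n=3$ the Gaussian curvature is $K=R_{1212}/\det g$. A reallocation from $A$ to $B$ is a (piecewise $C^1$) curve $\gamma:[0,1]\to\Delta^{n-1}$ with $\gamma(0)=A$, $\gamma(1)=B$. Its transition risk is the Riemannian length $\mathcal{R}[\gamma]=\int_0^1\sqrt{\dot\gamma(t)^{\mathsf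 T}G(\gamma(t))\dot\gamma(t)}\,dt$, which is invariant under reparametrisation. A risk-geodesic from $A$ to $B$ is a minimiser of $\mathcal{R}$ among such curves; in affine parametrisation it satisfies $\ddot u^k+\Gamma^k_{ij}(u)\dot u^i\dot u^j=0$ with $u(0)=u_A$, $u(1)=u_B$, where $u_A,u_B$ are the chart coordinates of $A,B$. *)

(* Defs.v *)
From HB Require Import structures.
From mathcomp Require Import all_boot all_order all_algebra.
From mathcomp Require Import all_classical all_reals all_analysis.

Set Implicit Arguments.
Unset Strict Implicit.
Unset Printing Implicit Defensive.

Import Order.TTheory GRing.Theory Num.Theory.
Import numFieldNormedType.Exports.

Local Open Scope classical_set_scope.
Local Open Scope ring_scope.

Definition quad_form {R : realType} {n : nat} (S : 'M[R]_n) (v : 'cV[R]_n) : R :=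
  (v^T *m S *m v) 0 0.

Definition sym_posdef {R : realType} {n : nat} (S : 'M[R]_n) : Prop :=
  S^T = S /\ forall v : 'cV[R]_n, v != 0 -> 0 < quad_form S v.

Definition open_simplex {R : realType} {n : nat} : set 'cV[R]_n :=
  [set w | (forall i, 0 < w i 0) /\ \sum_i w i 0 = 1].

(* Below, [d] is the dimension of the simplex, so portfolios live in
   'cV_d.+1 and chart coordinates in 'cV_d.  For [i : 'I_d.+1],
   [unlift ord_max i] is [None] for the last asset and otherwise [Some k],
   with [k : 'I_d] of the same value as [i]. *)

Definition embed {R : realType} {d : nat} (u : 'cV[R]_d) : 'cV[R]_d.+1 :=
  \col_i (if unlift ord_max i is Some k then u k 0 else 1 - \sum_k u k 0).

Definition embed_jac {R : realType} {d : nat} : 'M[R]_(d.+1, d) :=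
  \matrix_(i, j) (if unlift ord_max i is Some k then (k == j)%:R else -1).

Definition chart_domain {R : realType} {d : nat} : set 'cV[R]_d :=
  [set u | open_simplex (embed u)].

(* A risk metric is represented by a function on the whole of 'cV_d.+1; only
   its values on the open simplex are ever relevant, since the chart domain is
   open and all derivatives below are taken at its points. *)

Definition chart_metric {R : realType} {d : nat}
    (G : 'cV[R]_d.+1 -> 'M[R]_d.+1) (u : 'cV[R]_d) : 'M[R]_d :=
  embed_jac^T *m G (embed u) *m embed_jac.

Definition partial {R : realType} {d : nat} (i : 'I_d) (f : 'cV[R]_d -> R)
    (u : 'cV[R]_d) : R :=
  'D_(delta_mx i 0) f u.

(* [christoffel G k i j] is Gamma^k_{ij}. *)
Definition christoffel {R : realType} {d : nat}
    (G : 'cV[R]_d.+1 -> 'M[R]_d.+1) (k i j : 'I_d) (u : 'cV[R]_d) : R :=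
  2^-1 * \sum_l invmx (chart_metric G u) k l *
    (partial i (fun v => chart_metric G v j l) u
     + partial j (fun v => chart_metric G v i l) u
     - partial l (fun v => chart_metric G v i j) u).

(* [riemann G l i j k] is R^l_{ijk}, the d_l component of
   R(d_i, d_j) d_k. *)
Definition riemann {R : realType} {d : nat}
    (G : 'cV[R]_d.+1 -> 'M[R]_d.+1) (l i j k : 'I_d) (u : 'cV[R]_d) : R :=
  partial i (christoffel G l j k) u - partial j (christoffel G l i k) u
  + \sum_m christoffel G l i m u * christoffel G m j k u
  - \sum_m christoffel G l j m u * christoffel G m i k u.

(* The covariant tensor R_{abij} = g(R(d_i, d_j) d_b, d_a): the vector
   argument [b] is the last lower index of [riemann].  With this ordering
   R_{1212} / det g is positive on round spheres. *)
Definition riemann_cov {R : realType} {d : nat}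
    (G : 'cV[R]_d.+1 -> 'M[R]_d.+1) (a b i j : 'I_d) (u : 'cV[R]_d) : R :=
  \sum_l chart_metric G u a l * riemann G l i j b u.

(* R_{1212} / det g; meaningful as the Gaussian curvature when the manifold
   is a surface, i.e. d = 1 here ([ord0] and [ord_max] are then the two chart
   indices). *)
Definition gaussian_curvature {R : realType} {d : nat}
    (G : 'cV[R]_d.+2 -> 'M[R]_d.+2) (u : 'cV[R]_d.+1) : R :=
  riemann_cov G ord0 ord_max ord0 ord_max u / \det (chart_metric G u).

Definition flat {R : realType} {d : nat}
    (G : 'cV[R]_d.+1 -> 'M[R]_d.+1) : Prop :=
  forall u, chart_domain u -> forall l i j k, riemann G l i j k u = 0.

(* C^1 on the closed interval [a, b]: continuous on it, differentiable in the
   interior, with a derivative extending continuously to the end points.  The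
   values of [f] outside [a, b] play no role. *)
Definition C1_on {R : realType} {V : normedModType R} (a b : R) (f : R -> V)
    : Prop :=
  derivable_oo_LRcontinuous f a b /\
  exists2 f' : R -> V,
    {within `[a, b], continuous f'} & {in `]a, b[, derive1 f =1 f'}.

Definition piecewise_C1 {R : realType} {V : normedModType R} (f : R -> V)
    : Prop :=
  exists2 s : seq R, itv_partition 0 1 s &
    forall i, (i < size s)%N -> C1_on (nth 1 (0 :: s) i) (nth 1 s i) f.

Definition reallocation {R : realType} {n : nat} (A B : 'cV[R]_n)
    (gamma : R -> 'cV[R]_n) : Prop :=
  [/\ piecewise_C1 gamma,
      {in `[0, 1], forall t, open_simplex (gamma t)},
      gamma 0 = A
    & gamma 1 = B].

(* At the finitely many break points [derive1 gamma] may be meaningless, which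
   does not affect the integral. *)
Definition transition_risk {R : realType} {n : nat}
    (G : 'cV[R]_n -> 'M[R]_n) (gamma : R -> 'cV[R]_n) : R :=
  \int[lebesgue_measure]_(t in `[0, 1])
    Num.sqrt (quad_form (G (gamma t)) (derive1 gamma t)).

Definition risk_geodesic {R : realType} {n : nat} (G : 'cV[R]_n -> 'M[R]_n)
    (A B : 'cV[R]_n) (gamma : R -> 'cV[R]_n) : Prop :=
  reallocation A B gamma /\
  forall eta, reallocation A B eta ->
    transition_risk G gamma <= transition_risk G eta.

(* [phi] is only weakly monotone because a piecewise C^1 curve is allowed to
   pause. *)
Definition reparametrisation_of {R : realType} {n : nat}
    (p gamma : R -> 'cV[R]_n) : Prop :=
  exists phi : R -> R,
    [/\ piecewise_C1 phi,
        {in `[0, 1] &, {homo phi : s t / s <= t}},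
        phi 0 = 0, phi 1 = 1
      & {in `[0, 1], forall t, gamma t = p (phi t)}].

Definition segment {R : realType} {n : nat} (A B : 'cV[R]_n) (t : R)
    : 'cV[R]_n :=
  (1 - t) *: A + t *: B.

(* Main.v *)
(* Since g is constant in the chart, its derivatives vanish, and with them the
   Christoffel symbols and the curvature.

   Let |.| be the norm of the inner product <x, y> = x^T Sigma y.  Integrating
   <v, gamma'> <= |v| |gamma'| with v = gamma(y) - gamma(x) shows that the
   length of gamma over [x, y] is at least |gamma(y) - gamma(x)|, so the
   segment, of length |B - A|, is minimal.  If gamma has length at most |B - A|
   then, by additivity of the length, for all x <= y
     |gamma(x) - A| + |gamma(y) - gamma(x)| + |B - gamma(y)| <= |B - A|.
   Cauchy-Schwarz on the outer two terms turns this into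
     |gamma(y) - gamma(x)| |B - A| <= <gamma(y) - gamma(x), B - A>.
   Hence phi(t) = <gamma(t) - A, B - A> / <B - A, B - A> is nondecreasing, and
   the equality case of Cauchy-Schwarz (x = 0) puts gamma(t) at
   A + phi(t) (B - A). *)

From HB Require Import structures.
Require Import Defs.
From mathcomp Require Import all_boot all_order all_algebra.
From mathcomp Require Import all_classical all_reals all_analysis.
From mathcomp Require Import measurable_realfun ring lra.

Set Implicit Arguments.
Unset Strict Implicit.
Unset Printing Implicit Defensive.

Import Order.TTheory GRing.Theory Num.Theory.
Import numFieldNormedType.Exports.

Local Open Scope classical_set_scope.
Local Open Scope ring_scope.

Lemma continuous_mul {R : realType} {T : topologicalType} (f g : T -> R) :
  continuous f -> continuous g -> continuous (fun x => f x * g x).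
Proof. by move=> cf cg x; exact: cvgM (cf x) (cg x). Qed.

(** * The inner product [x^T S y]: Cauchy-Schwarz and its equality case *)

Section Inner.
Context {R : realType} {n : nat} (S : 'M[R]_n).

Definition inner (x y : 'cV[R]_n) : R := (x^T *m S *m y) 0 0.

Lemma inner_is_linear x : scalar (inner x).
Proof. by move=> a u v; rewrite /inner linearP !mxE. Qed.

HB.instance Definition _ x :=
  GRing.isLinear.Build R 'cV[R]_n R *%R (inner x) (inner_is_linear x).

(** Expanding [y] in the standard basis makes [L] a finite sum of coordinate functions with constant
    coefficients. *)
Lemma scalar_continuous (L : {scalar 'cV[R]_n}) : continuous L.
Proof.
have -> : (L : 'cV[R]_n -> R) = (fun y => \sum_j y j 0 * L (delta_mx j 0)).
  apply/funext => y; rewrite [in LHS](matrix_sum_delta y) linear_sum.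
  by apply: eq_bigr => j _; rewrite big_ord1 linearZ.
apply: continuous_big; first exact: add_continuous.
by move=> j _; apply: continuous_mul;
  [exact: coord_continuous|exact: cst_continuous].
Qed.

Lemma inner_diag x : inner x x = quad_form S x. Proof. by []. Qed.

Lemma quad_form_continuous : continuous (quad_form S).
Proof.
have -> : quad_form S = (fun y : 'cV[R]_n =>
    \sum_j (\sum_i y i 0 * S i j) * y j 0).
  apply/funext => y; rewrite /quad_form !mxE; apply: eq_bigr => j _.
  by rewrite mxE; congr (_ * _); apply: eq_bigr => i _; rewrite mxE.
apply: continuous_big; first exact: add_continuous.
move=> j _; apply: continuous_mul; last exact: coord_continuous.
apply: continuous_big; first exact: add_continuous.
by move=> i _; apply: continuous_mul;
  [exact: coord_continuous|exact: cst_continuous].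
Qed.

Definition qnorm (x : 'cV[R]_n) : R := Num.sqrt (quad_form S x).

Lemma qnorm_continuous : continuous qnorm.
Proof.
move=> x; apply: continuous_comp; first exact: quad_form_continuous.
exact: sqrt_continuous.
Qed.

Lemma qnorm_ge0 x : 0 <= qnorm x. Proof. exact: sqrtr_ge0. Qed.

Context (S_spd : sym_posdef S).

Lemma innerC x y : inner x y = inner y x.
Proof.
rewrite /inner -[in RHS]S_spd.1 -[y^T *m _ *m x]trmxK [in RHS]mxE.
by rewrite !trmx_mul !trmxK mulmxA.
Qed.

Lemma quad_form_ge0 x : 0 <= quad_form S x.
Proof.
have [->|/S_spd.2/ltW//] := eqVneq x 0.
by rewrite -inner_diag linear0.
Qed.

Lemma sqr_qnorm x : qnorm x ^+ 2 = inner x x.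
Proof. by rewrite sqr_sqrtr ?quad_form_ge0. Qed.

Lemma qnorm0 : qnorm 0 = 0.
Proof. by rewrite /qnorm -inner_diag linear0 sqrtr0. Qed.

Lemma qnorm_gt0 x : x != 0 -> 0 < qnorm x.
Proof. by move=> x0; rewrite sqrtr_gt0 S_spd.2. Qed.

(** [z] is the component of [x] orthogonal to [y]. Nonnegativity of its square is Cauchy-Schwarz;
    its vanishing is the equality case. *)
Lemma inner_sub_proj x y : y != 0 ->
  let z := x - (inner y x / inner y y) *: y in
  inner z z = inner x x - inner x y ^+ 2 / inner y y.
Proof.
move=> y0 /=; have yy0 : inner y y != 0 by rewrite gt_eqF// S_spd.2.
set c := inner y x / _; set z := x - _.
have zE u : inner z u = inner x u - c * inner y u.
  by rewrite (innerC z) linearB linearZ /= !(innerC u).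
rewrite {2}/z linearB linearZ /= !zE (innerC y x) /c (innerC y x).
by field.
Qed.

Lemma inner_le_qnorm x y : inner x y <= qnorm x * qnorm y.
Proof.
have [->|y0] := eqVneq y 0; first by rewrite linear0 mulr_ge0 ?qnorm_ge0.
have yy0 : 0 < inner y y by exact: S_spd.2.
rewrite (le_trans (ler_norm _))// -(@ler_pXn2r _ 2)//
  ?nnegrE ?mulr_ge0 ?qnorm_ge0//.
rewrite exprMn !sqr_qnorm real_normK ?num_real// -ler_pdivrMr// -subr_ge0.
by rewrite -inner_sub_proj// inner_diag quad_form_ge0.
Qed.

(** A nonzero orthogonal component would have positive square and make Cauchy-Schwarz strict,
    against the hypothesis. *)
Lemma inner_ge_qnorm_collinear x y : y != 0 -> qnorm x * qnorm y <= inner x y ->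
  x = (inner y x / inner y y) *: y.
Proof.
move=> y0 xy; have yy0 : 0 < inner y y by exact: S_spd.2.
apply/eqP; rewrite -subr_eq0; apply: contraT => /S_spd.2.
rewrite -inner_diag inner_sub_proj// subr_gt0 ltr_pdivrMr// => /lt_geF/negP[].
by rewrite -!sqr_qnorm -exprMn lerXn2r ?nnegrE ?(le_trans _ xy)
  ?mulr_ge0 ?qnorm_ge0.
Qed.

Lemma qnormD x y : qnorm (x + y) <= qnorm x + qnorm y.
Proof.
have [xy0|xy0] := eqVneq (x + y) 0.
  by rewrite xy0 qnorm0 addr_ge0 ?qnorm_ge0.
(* Multiplied by [qnorm S (x + y)], the left side splits as [<x + y, x> + <x + y, y>], and
   Cauchy-Schwarz bounds each term. *)
rewrite -(ler_pM2l (qnorm_gt0 xy0)) -expr2 sqr_qnorm linearD mulrDr.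
by rewrite lerD ?inner_le_qnorm.
Qed.

End Inner.

(** * C^1 curves: restriction, continuous linear images, translation *)

Section C1.
Context {R : realType}.

Lemma C1_on_itvS {V : normedModType R} (a b c d : R) (f : R -> V) :
  a <= c -> c < d -> d <= b -> C1_on a b f -> C1_on c d f.
Proof.
move=> ac cd db [df [f' cf' ff']]; split.
  by apply: derivable_oo_continuousW df => //;
    apply: subset_itv; rewrite bnd_simp.
exists f'.
  by apply: continuous_subspaceW cf'; apply: subset_itv; rewrite bnd_simp.
by move=> x; rewrite in_itv/= => /andP[cx xd]; apply: ff'; rewrite in_itv/=
  (le_lt_trans ac cx) (lt_le_trans xd db).
Qed.

(** [L] commutes with difference quotients by linearity and with their limit by continuity. *)
Lemma is_derive_scalar {V : normedModType R} (L : {scalar V}) (f : R -> V) t :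
  continuous L -> derivable f t 1 -> is_derive t 1 (L \o f) (L (derive1 f t)).
Proof.
move=> cL df.
have cvgL : h^-1 *: ((L \o f) (h *: 1 + t) - (L \o f) t) @[h --> 0^']
    --> L (derive1 f t).
  rewrite derive1E.
  rewrite (_ : (fun h => _) =
    L \o (fun h : R => h^-1 *: ((f \o shift t) (h *: 1) - f t))); last first.
    by apply/funext => h; rewrite /= [RHS]linearZ [in RHS]linearB.
  exact: cvg_comp df (cL _).
by apply: DeriveDef; [apply/cvg_ex; exists (L (derive1 f t))|exact/cvg_lim].
Qed.

Lemma C1_on_scalar {V : normedModType R} (L : {scalar V}) (a b : R)
    (f : R -> V) :
  continuous L -> C1_on a b f -> C1_on a b (L \o f).
Proof.
move=> cL [[df fa fb] [f' cf' ff']]; split; first split.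
- by move=> x /df dfx; have [] := is_derive_scalar cL dfx.
- exact: cvg_comp fa (cL _).
- exact: cvg_comp fb (cL _).
exists (L \o f').
  by apply: within_continuous_comp cf' => x _; exact: cL.
move=> x xab; rewrite derive1E; have [_ ->] := is_derive_scalar cL (df _ xab).
by rewrite /= ff'.
Qed.

Lemma C1_on_addr {V : normedModType R} (a b : R) (c : V) (f : R -> V) :
  C1_on a b f -> C1_on a b (fun t => f t + c).
Proof.
move=> [[df fa fb] [f' cf' ff']].
have dfc t : derivable f t 1 -> is_derive t 1 (fun t => f t + c) (derive1 f t).
  move=> dft; rewrite derive1E -[X in is_derive _ _ _ X]addr0.
  by apply: is_deriveD; exact: DeriveDef.
split; first split.
- by move=> t /df/dfc[].
- exact: cvgD fa (cvg_cst c).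
- exact: cvgD fb (cvg_cst c).
exists f' => // t tab; rewrite derive1E.
by have [_ ->] := dfc _ (df _ tab); exact: ff'.
Qed.

Lemma piecewise_C1_scalar {V : normedModType R} (L : {scalar V}) (f : R -> V) :
  continuous L -> piecewise_C1 f -> piecewise_C1 (L \o f).
Proof.
by move=> cL [s s01 C1f]; exists s => // i /C1f; exact: C1_on_scalar.
Qed.

End C1.

(** * Integrals over adjacent closed intervals *)

Section IntervalIntegral.
Context {R : realType}.
Let mu := @lebesgue_measure R.

(** The end points are Lebesgue-null. This matters because [C1_on] does not control [derive1 f]
    there. *)
Lemma integrable_itvoo_itvcc (h : R -> R) (a b : R) :
  mu.-integrable `]a, b[ (EFin \o h) -> mu.-integrable `[a, b] (EFin \o h).
Proof.
move=> /integrableP[mh ih]; apply/integrableP.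
split; first exact: emeasurable_fun_itv_cc mh.
by rewrite integral_itv_bndoo//; exact: measurableT_comp.
Qed.

Lemma Rintegral_itv_split (h : R -> R) (a b c : R) : a <= c -> c <= b ->
  mu.-integrable `[a, b] (EFin \o h) ->
  \int[mu]_(t in `[a, b]) h t =
  \int[mu]_(t in `[a, c]) h t + \int[mu]_(t in `[c, b]) h t.
Proof.
move=> ac cb ih.
have /(_ _ _)/eqP := @Rintegral_itvB _ h (BLeft a) (BRight b) c ih.
rewrite !bnd_simp => /(_ ac cb); rewrite subr_eq addrC => /eqP ->.
(* Additivity leaves the half-open []c, b]]; adding the null point [c] closes it. *)
congr (_ + _); apply: Rintegral_itv_obnd_cbnd.
by apply: integrableS ih => //; apply: subset_itv; rewrite bnd_simp.
Qed.

Lemma integrable_itv_cat (h : R -> R) (a b c : R) : a <= c -> c <= b ->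
  mu.-integrable `[a, c] (EFin \o h) -> mu.-integrable `[c, b] (EFin \o h) ->
  mu.-integrable `[a, b] (EFin \o h).
Proof.
move=> ac cb /integrableP[m1 i1] i2.
(* The right piece is opened at [c] to make the two pieces disjoint. *)
have /integrableP[m2 {}i2] : mu.-integrable `]c, b] (EFin \o h).
  by apply: integrableS i2 => //; apply: subset_itv; rewrite bnd_simp.
have E : `[a, b]%classic = `[a, c]%classic `|` `]c, b]%classic :> set R.
  by rewrite (@itv_bndbnd_setU _ _ _ (BRight c)).
have m12 : measurable_fun `[a, b] (EFin \o h).
  by rewrite E; apply/measurable_funU.
apply/integrableP; split => //.
rewrite E ge0_integral_setU//; first exact: lte_add_pinfty.
  by rewrite -E; exact: measurableT_comp.
apply/disj_setPS => x [/=]; rewrite !in_itv/= => /andP[_ xc] /andP[cx _].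
by move: cx; rewrite ltNge xc.
Qed.

End IntervalIntegral.

(** * The length of a piecewise C^1 curve dominates its chords *)

Section Length.
Context {R : realType}.
Let mu := @lebesgue_measure R.
Context {n : nat} (S : 'M[R]_n) (S_spd : sym_posdef S).

Definition speed (f : R -> 'cV[R]_n) (t : R) : R := qnorm S (derive1 f t).

(** Inside the interval the speed is [qnorm S \o f'], which is continuous on the compact
    [[a, b]]. *)
Lemma C1_on_speed_integrable (a b : R) (f : R -> 'cV[R]_n) : C1_on a b f ->
  mu.-integrable `[a, b] (EFin \o speed f).
Proof.
move=> [df [f' cf' ff']]; apply: integrable_itvoo_itvcc.
apply: (@eq_integrable _ _ _ mu _ _ (EFin \o (qnorm S \o f'))) => //.
  by move=> x; rewrite inE /= => /ff' xab; rewrite /speed xab.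
have if'N : mu.-integrable `[a, b] (EFin \o (qnorm S \o f')).
  apply: continuous_compact_integrable; first exact: segment_compact.
  by apply: within_continuous_comp cf' => x _; exact: qnorm_continuous.
by apply: integrableS if'N => //; apply: subset_itv; rewrite bnd_simp.
Qed.

Lemma C1_on_chord_le_length (a b : R) (f : R -> 'cV[R]_n) : a < b ->
  C1_on a b f ->
  qnorm S (f b - f a) <= \int[mu]_(t in `[a, b]) speed f t.
Proof.
move=> ab C1f; set v := f b - f a.
have [->|v0] := eqVneq v 0.
  by rewrite qnorm0; apply: Rintegral_ge0 => x _; exact: qnorm_ge0.
have cL := @scalar_continuous _ _ (inner S v).
have [dL _] := C1_on_scalar cL C1f.
have ispeed := C1_on_speed_integrable C1f.
have [[df _ _] [f' cf' ff']] := C1f.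
have cf'L : {within `[a, b], continuous (inner S v \o f')}.
  by apply: within_continuous_comp cf' => x _; exact: cL.
have cf'N : {within `[a, b], continuous (qnorm S \o f')}.
  by apply: within_continuous_comp cf' => x _; exact: qnorm_continuous.
have if'N : mu.-integrable `[a, b] (EFin \o (qnorm S \o f')).
  by apply: continuous_compact_integrable => //; exact: segment_compact.
(* On [[a, b]], [derive1 f] and its extension [f'] can differ only at the end points. *)
have -> : \int[mu]_(t in `[a, b]) speed f t =
    \int[mu]_(t in `[a, b]) qnorm S (f' t).
  have mo h : mu.-integrable `[a, b] (EFin \o h) -> measurable_fun `]a, b[ h.
    move=> /measurable_int/measurable_EFinP; apply: measurable_funS => //.
    by apply: subset_itv; rewrite bnd_simp.
  rewrite /Rintegral; congr fine; apply: eq_integral_itv_bounded; try exact: mo.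
  by move=> x /ff'; rewrite /speed => ->.
(* Multiplied by [qnorm S v], the left side is [<v, v>], the increment of [<v, f>] over [[a, b]];
   the fundamental theorem of calculus turns it into an integral. *)
rewrite -(ler_pM2r (qnorm_gt0 S_spd v0)) -expr2 sqr_qnorm//.
have -> : inner S v v = \int[mu]_(t in `[a, b]) inner S v (f' t).
  rewrite /Rintegral (continuous_FTC2 ab cf'L dL)/= /v ?linearB//.
  move=> x xab; rewrite derive1E.
  by have [_ ->] := is_derive_scalar cL (df _ xab); rewrite /= ff'.
rewrite -RintegralZr//; apply: le_Rintegral => //.
- by apply: continuous_compact_integrable => //; exact: segment_compact.
- exact: (integrableZr _ (qnorm S v)) if'N.
- by move=> x _; rewrite innerC// inner_le_qnorm.
Qed.

Lemma C1_on_chord_le_lengthW (a b x y : R) (f : R -> 'cV[R]_n) : C1_on a b f ->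
  a <= x -> x <= y -> y <= b ->
  qnorm S (f y - f x) <= \int[mu]_(t in `[x, y]) speed f t.
Proof.
move=> C1f ax + yb; rewrite le_eqVlt => /predU1P[<-|xy].
  by rewrite subrr qnorm0; apply: Rintegral_ge0 => t _; exact: qnorm_ge0.
by apply: C1_on_chord_le_length => //; exact: C1_on_itvS C1f.
Qed.

(** Induction on the break points. Integrability is carried along because additivity of the length
    needs it. *)
Lemma piecewise_C1_chord_le_length (e a b : R) (s : seq R) (f : R -> 'cV[R]_n) :
  itv_partition a b s ->
  (forall i, (i < size s)%N -> C1_on (nth e (a :: s) i) (nth e s i) f) ->
  mu.-integrable `[a, b] (EFin \o speed f) /\
  forall x y, a <= x -> x <= y -> y <= b ->
    qnorm S (f y - f x) <= \int[mu]_(t in `[x, y]) speed f t.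
Proof.
elim: s a => [|c s IH] a abs C1f.
  have <- := itv_partition_nil abs; split.
    rewrite set_itv1; apply: null_set_integrable => //.
      exact: measurable_fun_set1.
    exact: lebesgue_measure_set1.
  move=> x y ax xy yb; have -> : y = x by lra.
  by rewrite subrr qnorm0; apply: Rintegral_ge0 => t _; exact: qnorm_ge0.
have cbs := itv_partition_cons abs.
have ac : a <= c by case: abs => /= /andP[/ltW].
have cb : c <= b by exact: itv_partition_le cbs.
have C1ac : C1_on a c f by exact: (C1f 0%N).
have [icb lecb] := IH _ cbs (fun i => C1f i.+1).
have iab : mu.-integrable `[a, b] (EFin \o speed f).
  by apply: integrable_itv_cat icb => //; exact: C1_on_speed_integrable.
split => // x y ax xy yb.
have [yc|cy] := leP y c; first exact: C1_on_chord_le_lengthW C1ac ax xy yc.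
have [cx|xc] := leP c x; first exact: lecb.
(* Only [x < c < y] remains: the length splits at [c], and the chord by the triangle inequality. *)
rewrite (@Rintegral_itv_split _ _ x y c) ?(ltW xc) ?(ltW cy)//; last first.
  by apply: integrableS iab => //; apply: subset_itv; rewrite bnd_simp.
have -> : f y - f x = (f c - f x) + (f y - f c) by rewrite [RHS]addrC subrKA.
rewrite (le_trans (qnormD S_spd _ _))// lerD//.
  by apply: C1_on_chord_le_lengthW C1ac _ _ _ => //; rewrite ltW.
by rewrite lecb ?(ltW cy).
Qed.

End Length.

(** * Affine curves are C^1 *)

Section Smooth.
Context {R : realType} {V : normedModType R}.

Lemma is_derive_affine (u v : V) (t : R) :
  is_derive t 1 (fun x : R => u + x *: v) v.
Proof.
have H : h^-1 *: ((u + (h *: 1 + t) *: v) - (u + t *: v)) @[h --> (0 : R)^']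
    --> v.
  apply: (@cvg_trans _ (cst v @ (0 : R)^')); last exact: cvg_cst.
  apply: near_eq_cvg; near=> h.
  have h0 : h != 0 by near: h; exact: nbhs_dnbhs_neq.
  rewrite opprD addrACA subrr add0r -scalerBl addrK scalerA [h *: 1]mulr1.
  by rewrite mulVf ?scale1r.
by apply: DeriveDef; [apply/cvg_ex; exists v|exact/cvg_lim].
Unshelve. all: by end_near. Qed.

Lemma continuous_affine (u v : V) : continuous (fun x : R => u + x *: v).
Proof.
move=> t; apply/differentiable_continuous/derivable1_diffP.
by have [] := is_derive_affine u v t.
Qed.

Lemma C1_on_affine (a b : R) (u v : V) : C1_on a b (fun t => u + t *: v).
Proof.
have dV t := is_derive_affine u v t.
have cV := @continuous_affine u v.
split; first split.
- by move=> t _; have [] := dV t.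
- exact: cvg_at_right_filter (cV a).
- exact: cvg_at_left_filter (cV b).
exists (cst v); first by apply: continuous_subspaceT => x; exact: cvg_cst.
by move=> t _; rewrite derive1E; have [_ ->] := dV t.
Qed.

Lemma piecewise_C1_affine (u v : V) : piecewise_C1 (fun t : R => u + t *: v).
Proof.
exists [:: 1]; first exact: itv_partition1.
by case=> // _; exact: C1_on_affine.
Qed.

End Smooth.

(** * The segment as a reallocation *)

Section Segment.
Context {R : realType} {n : nat}.

Lemma segmentE (A B : 'cV[R]_n) : segment A B = (fun t => A + t *: (B - A)).
Proof.
apply/funext => t.
by rewrite /segment scalerBl scale1r scalerBr [RHS]addrA addrAC.
Qed.

Lemma open_simplex_segment (A B : 'cV[R]_n) t :
  open_simplex A -> open_simplex B ->
  t \in `[0, 1] -> open_simplex (segment A B t).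
Proof.
move=> [A0 A1] [B0 B1]; rewrite in_itv/= => /andP[t0 t1]; split.
  move=> i; rewrite !mxE.
  have := A0 i; have := B0 i; nra.
under eq_bigr do rewrite !mxE.
by rewrite big_split/= -!mulr_sumr A1 B1; lra.
Qed.

Lemma reallocation_segment (A B : 'cV[R]_n) :
  open_simplex A -> open_simplex B ->
  reallocation A B (segment A B).
Proof.
move=> sA sB; split.
- by rewrite segmentE; exact: piecewise_C1_affine.
- by move=> t; exact: open_simplex_segment.
- by rewrite /segment subr0 scale1r scale0r addr0.
- by rewrite /segment subrr scale1r scale0r add0r.
Qed.

End Segment.

(** * Minimality of the segment and uniqueness of the minimiser *)

Section Market.
Context {R : realType} {n : nat} (S : 'M[R]_n) (G : 'cV[R]_n -> 'M[R]_n).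
Context (S_spd : sym_posdef S).
Context (G_market : forall w, open_simplex w -> G w = S).
Let mu := @lebesgue_measure R.

(** A reallocation stays in the simplex, where [G] is known to equal [S]. *)
Lemma transition_risk_speed (A B : 'cV[R]_n) f : reallocation A B f ->
  transition_risk G f = \int[mu]_(t in `[0, 1]) speed S f t.
Proof.
move=> [_ fS _ _]; apply: eq_Rintegral => t; rewrite inE/= => t01.
by rewrite G_market//; exact: fS.
Qed.

Lemma transition_risk_segment (A B : 'cV[R]_n) :
  open_simplex A -> open_simplex B ->
  transition_risk G (segment A B) = qnorm S (B - A).
Proof.
move=> sA sB; rewrite (transition_risk_speed (reallocation_segment sA sB)).
rewrite (_ : speed S _ = cst (qnorm S (B - A))).
  rewrite Rintegral_cst//= lebesgue_measure_itv/= lte_fin ltr01 sube0/=.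
  by rewrite mulr1.
apply/funext => t; rewrite /speed derive1E segmentE.
by have [_ ->] := is_derive_affine A (B - A) t.
Qed.

Lemma segment_minimises (A B : 'cV[R]_n) f :
  open_simplex A -> open_simplex B ->
  reallocation A B f -> transition_risk G (segment A B) <= transition_risk G f.
Proof.
move=> sA sB fAB; rewrite transition_risk_segment// (transition_risk_speed fAB).
have [[s s01 C1f] _ <- <-] := fAB.
by have [_ ->] := piecewise_C1_chord_le_length S_spd s01 C1f.
Qed.

Lemma minimiser_reparametrises_segment (A B : 'cV[R]_n) f :
  open_simplex A -> open_simplex B ->
  reallocation A B f ->
  transition_risk G f <= transition_risk G (segment A B) ->
  reparametrisation_of (segment A B) f.
Proof.
move=> sA sB fAB; rewrite transition_risk_segment//.
rewrite (transition_risk_speed fAB) => fle.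
have [[s s01 C1f] _ f0 f1] := fAB.
have [ispeed chord] := piecewise_C1_chord_le_length S_spd s01 C1f.
have isub x y : 0 <= x -> y <= 1 -> mu.-integrable `[x, y] (EFin \o speed S f).
  move=> x0 y1; apply: integrableS ispeed => //.
  by apply: subset_itv; rewrite bnd_simp.
(* The length splits at [x] and [y] into three pieces, each at least its chord. *)
have detour x y : 0 <= x -> x <= y -> y <= 1 ->
    qnorm S (f x - A) + qnorm S (f y - f x) + qnorm S (B - f y) <=
    qnorm S (B - A).
  move=> x0 xy y1; apply: le_trans fle.
  rewrite (@Rintegral_itv_split _ _ 0 1 y) ?(le_trans x0)//.
  rewrite (@Rintegral_itv_split _ _ 0 y x) ?isub//.
  by rewrite -f0 -f1 !lerD// chord// ?(le_trans xy) ?(le_trans x0).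
(* If [A = B], [detour] at [x = y = t] forces [f t = A]. The identity then serves as [phi], written
   in affine form to get its regularity. *)
have [AB|v0] := eqVneq (B - A) 0.
  exists (fun t => 0 + t *: 1); split.
  - exact: piecewise_C1_affine.
  - by move=> x y _ _ xy; rewrite !add0r ![_ *: 1]mulr1.
  - by rewrite scale0r addr0.
  - by rewrite scale1r add0r.
  move=> t; rewrite in_itv/= => /andP[t0 t1].
  rewrite segmentE AB scaler0 addr0; apply/eqP; rewrite -subr_eq0.
  apply: contraT => /(qnorm_gt0 S_spd); rewrite ltNge => /negP[].
  have := detour t t t0 (lexx _) t1; rewrite AB qnorm0.
  have := qnorm_ge0 S (f t - f t); have := qnorm_ge0 S (B - f t); lra.
set v := B - A in v0 detour.
have vv0 : 0 < inner S v v by exact: S_spd.2.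
pose phi t := inner S v (f t - A) / inner S v v.
have increment x y : 0 <= x -> x <= y -> y <= 1 ->
    qnorm S (f y - f x) * qnorm S v <= inner S (f y - f x) v.
  move=> x0 xy y1.
  (* [f y - f x] is [v] minus the two outer chords; Cauchy-Schwarz on these and [detour] times
     [qnorm S v] conclude. *)
  have -> : inner S (f y - f x) v =
      inner S v v - inner S (f x - A) v - inner S (B - f y) v.
    rewrite !(innerC S_spd _ v) -!linearB /=; congr (inner S v _).
    by apply/matrixP => i j; rewrite !mxE; ring.
  have := detour _ _ x0 xy y1; rewrite -(ler_pM2r (qnorm_gt0 S_spd v0)).
  rewrite -expr2 sqr_qnorm// !mulrDl.
  have := inner_le_qnorm S_spd (f x - A) v.
  have := inner_le_qnorm S_spd (B - f y) v.
  lra.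
exists phi; split.
(* [phi] is a continuous linear functional of the translated curve, hence piecewise C^1 on the same
   partition. *)
- have -> : phi = inner S ((inner S v v)^-1 *: v) \o (fun t => f t + - A).
    apply/funext => t; rewrite /phi /= [RHS](innerC S_spd) linearZ /=.
    by rewrite mulrC (innerC S_spd v).
  apply: piecewise_C1_scalar; first exact: scalar_continuous.
  by exists s => // i /C1f; exact: C1_on_addr.
- move=> x y; rewrite !in_itv/= => /andP[x0 x1] /andP[y0 y1] xy.
  rewrite /phi ler_pM2r ?invr_gt0// -subr_ge0 -linearB opprB addrA subrK /=.
  rewrite (innerC S_spd); apply: le_trans (increment _ _ x0 xy y1).
  by rewrite mulr_ge0 ?qnorm_ge0.
- by rewrite /phi f0 subrr linear0 mul0r.
- by rewrite /phi f1 divff// gt_eqF.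
move=> t; rewrite in_itv/= => /andP[t0 t1].
(* From [x = 0], [increment] is the equality case: [f t - A] is [phi t] times [v]. *)
rewrite segmentE /phi; have := increment _ _ (lexx 0) t0 t1; rewrite f0.
move=> /(inner_ge_qnorm_collinear S_spd v0) <-.
by rewrite addrC subrK.
Qed.

End Market.

(** * Vanishing of the Christoffel symbols and of the curvature *)

Section Flat.
Context {R : realType} {d : nat}.

Lemma sum_embed (u : 'cV[R]_d) : \sum_i embed u i 0 = 1.
Proof.
rewrite big_ord_recr/= [embed u ord_max 0]mxE unlift_none.
rewrite (eq_bigr (fun k => u k 0)); first by rewrite addrC subrK.
(* Lifting at [ord_max] leaves every smaller index unchanged, so it agrees with [widen_ord]. *)
move=> k _; rewrite (_ : widen_ord _ k = lift ord_max k) ?mxE ?liftK//.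
by apply: val_inj; rewrite /= /bump leqNgt ltn_ord.
Qed.

Lemma embed_line (u e : 'cV[R]_d) i :
  exists c, forall h, embed (h *: e + u) i 0 = embed u i 0 + h *: c.
Proof.
case E : (unlift ord_max i) => [k|].
  by exists (e k 0) => h; rewrite !mxE E !mxE addrC.
exists (- \sum_k e k 0) => h; rewrite !mxE E.
under eq_bigr do rewrite !mxE.
by rewrite big_split -mulr_sumr /= [_ *: _]mulrN; ring.
Qed.

(** Finitely many strict inequalities between functions affine in [h] persist near 0; the sum
    condition is automatic. *)
Lemma chart_domain_near_line (u e : 'cV[R]_d) : chart_domain u ->
  \forall h \near (0 : R), chart_domain (h *: e + u).
Proof.
move=> [u0 _].
have H i : \forall h \near (0 : R), 0 < embed (h *: e + u) i 0.
  have [c E] := embed_line u e i.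
  have /= := @continuous_affine R R^o (embed u i 0) c 0.
  rewrite /continuous_at scale0r addr0 => /cvgr_gt /(_ _ (u0 i)).
  by apply: filterS => h; rewrite E.
near=> h; split; last exact: sum_embed.
by near: h; apply: filter_forall.
Unshelve. all: by end_near. Qed.

(** Nearby points on the coordinate line stay in the chart domain, so the difference quotient is
    eventually 0, whatever [f] is elsewhere. *)
Lemma partial_cst_chart (i : 'I_d) (f : 'cV[R]_d -> R) (c : R) (u : 'cV[R]_d) :
  (forall v, chart_domain v -> f v = c) -> chart_domain u -> partial i f u = 0.
Proof.
move=> fc du; rewrite /partial /derive; apply/cvg_lim => //.
apply: (@cvg_trans _ (cst 0 @ (0 : R)^')); last exact: cvg_cst.
apply: near_eq_cvg.
have := chart_domain_near_line (delta_mx i 0) du => /nbhs_dnbhs.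
by apply: filterS => h dh /=; rewrite !fc// subrr scaler0.
Qed.

Context (S : 'M[R]_d.+1) (G : 'cV[R]_d.+1 -> 'M[R]_d.+1).
Context (G_market : forall w, open_simplex w -> G w = S).

Lemma christoffel_cst k i j u : chart_domain u -> christoffel G k i j u = 0.
Proof.
move=> du; rewrite /christoffel big1 ?mulr0// => l _.
have gE a b v : chart_domain v ->
    chart_metric G v a b = (embed_jac^T *m S *m embed_jac) a b.
  by move=> dv; rewrite /chart_metric G_market.
by rewrite !(partial_cst_chart _ (gE _ _) du) addr0 subrr mulr0.
Qed.

Lemma flat_cst : flat G.
Proof.
move=> u du l i j k; rewrite /riemann.
(* The symbols vanish on the whole chart domain, so their partial derivatives vanish as well. *)
rewrite !(partial_cst_chart _ (@christoffel_cst _ _ _) du) subrr add0r.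
by rewrite !big1 ?subrr// => m _; rewrite christoffel_cst// mul0r.
Qed.

End Flat.

(* The number of assets is n = m.+2. *)
Theorem proposition1 (R : realType) (m : nat) (Sigma : 'M[R]_m.+2)
    (G : 'cV[R]_m.+2 -> 'M[R]_m.+2)
    (Sigma_spd : sym_posdef Sigma)
    (G_market : forall w, open_simplex w -> G w = Sigma) :
  [/\ forall u, chart_domain u -> forall k i j, christoffel G k i j u = 0,
      flat G /\
      (m.+2 = 3%N -> forall u, chart_domain u -> gaussian_curvature G u = 0),
      forall A B, open_simplex A -> open_simplex B ->
        risk_geodesic G A B (segment A B) /\
        (forall gamma, risk_geodesic G A B gamma ->
           reparametrisation_of (segment A B) gamma)
    & forall A B, open_simplex A -> open_simplex B ->
        forall gamma, reallocation A B gamma ->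
          transition_risk G (segment A B) <= transition_risk G gamma].
Proof.
split.
- by move=> u du k i j; exact: christoffel_cst G_market _ _ _ _ du.
- split; first exact: flat_cst G_market.
  move=> _ u du; rewrite /gaussian_curvature /riemann_cov.
  by rewrite big1 ?mul0r// => l _; rewrite (flat_cst G_market)// mulr0.
- move=> A B sA sB; split.
    split; first exact: reallocation_segment.
    by move=> eta; exact: (segment_minimises Sigma_spd G_market).
  move=> gamma [gAB gmin].
  apply: (minimiser_reparametrises_segment Sigma_spd G_market sA sB gAB).
  (* The segment is itself a competitor, so a geodesic is no longer than it. *)
  exact: gmin (reallocation_segment sA sB).
- by move=> A B sA sB gamma; exact: (segment_minimises Sigma_spd G_market).
Qed.
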